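(* Let $L\subset\mathbb{R}^m$ and $M\subset\mathbb{R}^n$ be lattices. Then for every (nonzero) tensor $\mathbf v\in L\otimes M$ of rank $r$ we have $$\lVert \mathbf v \rVert \geq \sqrt{\frac{r}{\gamma_r^2}}\;\lambda_1(L\otimes M),$$ where $\gamma_r$ is the $r$-th Hermite constant.
   Context: A (full) lattice in $\mathbb{R}^n$ is the free abelian group generated by $n$ linearly independent vectors of $\mathbb{R}^n$; if $\mathbf b_1,\dots,\mathbf b_n$ are such generators, $\det L=|\det(\mathbf b_1|\cdots|\mathbf b_n)|$. $\lambda_1(L)$ denotes the Euclidean length of a shortest nonzero vector of $L$. The $r$-th Hermite constant is $\gamma_r=\sup_L\left(\lambda_1(L)/(\det L)^{1/r}\right)^2$, the supremum being over all full lattices $L$ in $\mathbb{R}^r$. For lattices $L\subset\mathbb{R}^m$ and $M\subset\mathbb{R}^n$, $L\otimes M$ is the set of integral linear combinations of tensors $\mathbf x\otimes\mathbf y\in\mathbb{R}^m\otimes_{\mathbb{R}}\mathbb{R}^n$ with $\mathbf x\in L$, $\mathbf y\in M$. The space $\mathbb{R}^m\otimes_{\mathbb{R}}\mathbb{R}^n$ is Euclidean with inner product determined by $\langle \mathbf x_1\otimes \mathbf y_1,\mathbf x_2\otimes\mathbf y_2\rangle=\langle\mathbf x_1,\mathbf x_2\rangle\langle\mathbf y_1,\mathbf y_2\rangle$, and $\lVert\cdot\rVert$ is the corresponding norm (equivalently, the Frobenius norm under the identification of $\mathbf x\otimes\mathbf y$ with the $m\times n$ matrix $\mathbf x\mathbf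 y^T$). The rank of a nonzero tensor $\mathbf v\in L\otimes M$ is the smallest positive integer $r$ such that $\mathbf v=\sum_{i=1}^r\mathbf x_i\otimes\mathbf y_i$ for some $\mathbf x_1,\dots,\mathbf x_r\in L$ and $\mathbf y_1,\dots,\mathbf y_r\in M$. *)

(* Defs.v *)
From HB Require Import structures.
From mathcomp Require Import all_boot all_order all_algebra.
From mathcomp Require Import all_classical all_reals all_analysis.

Set Implicit Arguments.
Unset Strict Implicit.
Unset Printing Implicit Defensive.

Import Order.TTheory GRing.Theory Num.Theory.

Local Open Scope classical_set_scope.
Local Open Scope ring_scope.

(* Vectors of R^n are row vectors and R^m (x) R^n is modelled by 'M[R]_(m, n),
   the pure tensor x (x) y being the matrix x^T *m y; row vectors are the case
   m = 1, so the norm and lambda1 below serve for lattices and for their tensor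
   products alike. *)

Definition tensor (R : realType) (m n : nat) (x : 'rV[R]_m) (y : 'rV[R]_n) :
  'M[R]_(m, n) := x^T *m y.

Definition mxdot (R : realType) (m n : nat) (A B : 'M[R]_(m, n)) : R :=
  \sum_(i < m) \sum_(j < n) A i j * B i j.

(* Not the library's `|A|, which is the sup norm on matrices. *)
Definition l2norm (R : realType) (m n : nat) (A : 'M[R]_(m, n)) : R :=
  Num.sqrt (mxdot A A).

Lemma mxdot_tensor (R : realType) (m n : nat)
    (x1 x2 : 'rV[R]_m) (y1 y2 : 'rV[R]_n) :
  mxdot (tensor x1 y1) (tensor x2 y2) = mxdot x1 x2 * mxdot y1 y2.
Proof.
rewrite /mxdot !big_ord1 big_distrlr /=.
apply: eq_bigr => i _; apply: eq_bigr => j _.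
by rewrite /tensor !mxE !big_ord1 !mxE mulrACA.
Qed.

Definition is_lattice_basis (R : realType) (n : nat) (B : 'M[R]_n)
    (L : set 'rV[R]_n) : Prop :=
  row_free B /\ L = [set \sum_(i < n) row i B *~ z i | z in [set: 'I_n -> int]].

Definition is_lattice (R : realType) (n : nat) (L : set 'rV[R]_n) : Prop :=
  exists B : 'M[R]_n, is_lattice_basis B L.

(* For a nonzero lattice the infimum is attained. *)
Definition lambda1 (R : realType) (m n : nat) (L : set 'M[R]_(m, n)) : R :=
  inf [set l2norm v | v in [set v | L v /\ v != 0]].

(* det L is |det B| for any basis B of L, so ranging over all pairs (L, B) is
   ranging over all lattices.  The set is bounded above for r >= 1, by
   Hermite's theorem, so that this real-valued sup is the actual supremum. *)
Definition hermite_constant (R : realType) (r : nat) : R :=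
  sup [set g : R | exists (L : set 'rV[R]_r) (B : 'M[R]_r),
    is_lattice_basis B L /\
    g = (lambda1 L / (`|\det B| `^ (r%:R^-1))) ^+ 2].

Definition tensor_lattice (R : realType) (m n : nat)
    (L : set 'rV[R]_m) (M : set 'rV[R]_n) : set 'M[R]_(m, n) :=
  [set v | exists (k : nat) (z : 'I_k -> int)
             (x : 'I_k -> 'rV[R]_m) (y : 'I_k -> 'rV[R]_n),
    [/\ forall i, L (x i), forall i, M (y i) &
        v = \sum_(i < k) tensor (x i) (y i) *~ z i]].

Definition sum_of_tensors (R : realType) (m n : nat)
    (L : set 'rV[R]_m) (M : set 'rV[R]_n) (v : 'M[R]_(m, n)) (r : nat) : Prop :=
  exists (x : 'I_r -> 'rV[R]_m) (y : 'I_r -> 'rV[R]_n),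
    [/\ forall i, L (x i), forall i, M (y i) &
        v = \sum_(i < r) tensor (x i) (y i)].

Definition has_tensor_rank (R : realType) (m n : nat)
    (L : set 'rV[R]_m) (M : set 'rV[R]_n) (v : 'M[R]_(m, n)) (r : nat) : Prop :=
  [/\ (0 < r)%N, sum_of_tensors L M v r &
      forall s : nat, (0 < s)%N -> sum_of_tensors L M v s -> (r <= s)%N].

(* Main.v *)
(* If v = sum_(i < r) x_i (x) y_i with r minimal, then the x_i, and likewise the
   y_i, are linearly independent: otherwise the lattice they span would have
   fewer than r generators.  With A, B the Gram matrices of the x_i and y_i,
   ||v||^2 = tr (A B) >= r (det A det B)^(1/r) by Hadamard's inequality and
   AM-GM.  The x_i span a rank r sublattice of L, of determinant sqrt (det A)
   and isometric to a full lattice of R^r by a Cholesky factor of A, so that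
   lambda1(L)^2 <= gamma_r (det A)^(1/r); similarly for M.  Finally
   lambda1(L (x) M) <= lambda1(L) lambda1(M). *)

Require Import Defs.
From mathcomp Require Import all_boot all_order all_algebra.
From mathcomp Require Import all_classical all_reals all_analysis.
Set Implicit Arguments.
Unset Strict Implicit.

Import Order.TTheory GRing.Theory Num.Theory.
Local Open Scope classical_set_scope.
Local Open Scope ring_scope.

(** * Positive definite matrices and the trace-determinant inequality *)

Section PositiveDefinite.
Context {R : realType}.

Definition posdef (r : nat) (A : 'M[R]_r) : Prop :=
  A^T = A /\ forall u : 'rV_r, u != 0 -> 0 < \tr (u *m A *m u^T).

Lemma mxdotE (m n : nat) (A B : 'M[R]_(m, n)) : mxdot A B = \tr (A *m B^T).
Proof.
rewrite /mxdot /mxtrace; apply: eq_bigr => i _; rewrite mxE.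
by apply: eq_bigr => j _; rewrite mxE.
Qed.

Lemma mxdot_ge0 (m n : nat) (A : 'M[R]_(m, n)) : 0 <= mxdot A A.
Proof. by do 2![apply: sumr_ge0 => ? _]; rewrite -expr2 sqr_ge0. Qed.

Lemma mxdot_gt0 (m n : nat) (A : 'M[R]_(m, n)) : A != 0 -> 0 < mxdot A A.
Proof.
move=> A0; rewrite lt0r mxdot_ge0 andbT; apply: contraNneq A0 => A0.
have ge0 i j : 0 <= A i j * A i j by rewrite -expr2 sqr_ge0.
apply/eqP/matrixP => i j; rewrite mxE; apply/eqP.
have/psumr_eq0P/(_ i isT)/psumr_eq0P/(_ j isT) := A0.
by move=> H; rewrite -[_ == _]orbb -mulf_eq0 H// => k _; apply: sumr_ge0.
Qed.

(** The form at [u] is the squared norm of [u *m X], which is nonzero when the rows of [X] are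
    free. *)
Lemma gram_posdef (r n : nat) (X : 'M[R]_(r, n)) :
  row_free X -> posdef (X *m X^T).
Proof.
move=> Xf; split=> [|u u0]; first by rewrite trmx_mul trmxK.
rewrite mulmxA -mulmxA -trmx_mul -mxdotE; apply: mxdot_gt0.
by rewrite -(inj_eq (row_free_inj Xf)) mul0mx in u0.
Qed.

(** Induction on the size: the Schur complement of the top left entry is again positive definite. *)
Lemma cholesky (r : nat) (A : 'M[R]_r) :
  posdef A -> exists2 T : 'M[R]_r, is_trig_mx T & A = T *m T^T.
Proof.
elim: r A => [|r IHr] A.
  by move=> _; exists 0; [exact: mx0_is_trig | rewrite [LHS]flatmx0 [RHS]flatmx0].
rewrite -[r.+1]/(1 + r)%N in A *.
rewrite -[A]submxK [ulsubmx A]mx11_scalar; move: (ulsubmx A 0 0) => a.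
move: (ursubmx A) (dlsubmx A) (drsubmx A) => b b' C [].
rewrite tr_block_mx => /eq_block_mx[_ _ <- CE] Apos {b'}.
have a_gt0 : 0 < a.
  have := Apos (row_mx 1%:M 0); rewrite mul_row_block tr_row_mx mul_row_col.
  rewrite !(mul0mx, mulmx0, addr0, trmx0) trmx1 mul1mx mulmx1 mxtrace_scalar.
  apply; rewrite -row_mx0; apply/eqP => /eq_row_mx[/matrixP/(_ 0 0)/eqP].
  by rewrite !mxE eqxx oner_eq0.
have [|T Ttrig TE] := IHr (C - a^-1 *: (b^T *m b)).
  split=> [|w w0].
    by rewrite linearB linearZ /= trmx_mul trmxK CE.
  (* The first block of this vector times the matrix vanishes, so the form reduces to that of the
     Schur complement at [w]. *)
  have := Apos (row_mx (- a^-1 *: (w *m b^T)) w); rewrite mul_row_block.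
  rewrite tr_row_mx mul_row_col mul_mx_scalar scalerA mulrN mulfV ?gt_eqF//.
  rewrite scaleN1r addNr mul0mx add0r -scalemxAl !scaleNr addrC -(mulmxA w).
  rewrite [w *m (C - _)]mulmxBr -[w *m (_ *: _)]scalemxAr; apply.
  by rewrite -row_mx0; apply: contraNneq w0 => /eq_row_mx[_ ->].
exists (block_mx (Num.sqrt a)%:M 0 ((Num.sqrt a)^-1 *: b^T) T).
  by rewrite is_trig_block_mx// eqxx/= Ttrig scalar_mx_is_trig.
rewrite tr_block_mx mulmx_block trmx0 !(mulmx0, mul0mx, addr0).
rewrite tr_scalar_mx -scalar_mxM -expr2 sqr_sqrtr ?ltW//.
rewrite linearZ /= trmxK mul_mx_scalar mul_scalar_mx !scalerA.
have s0 : Num.sqrt a != 0 by rewrite gt_eqF// sqrtr_gt0.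
rewrite mulfV// !scale1r -scalemxAl -scalemxAr scalerA -invfM -expr2.
by rewrite sqr_sqrtr ?ltW// -TE addrC subrK.
Qed.

Lemma det_gram_square (r : nat) (T : 'M[R]_r) :
  \det (T *m T^T) = \det T ^+ 2.
Proof. by rewrite det_mulmx det_tr. Qed.

Lemma posdef_det_gt0 (r : nat) (A : 'M[R]_r) : posdef A -> 0 < \det A.
Proof.
move=> Apos; have [T _ AE] := cholesky Apos.
rewrite AE det_gram_square lt0r sqr_ge0 andbT sqrf_eq0.
apply/det0P => -[u u0 uT]; have := Apos.2 _ u0.
by rewrite AE mulmxA uT !mul0mx mxtrace0 ltxx.
Qed.

(* Hadamard's inequality for the Cholesky factor, then AM-GM on the diagonal. *)
Lemma posdef_det_le_trace (r : nat) (A : 'M[R]_r) :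
  posdef A -> \det A <= (\tr A / r%:R) ^+ r.
Proof.
move=> Apos; have [T Ttrig AE] := cholesky Apos.
have diag i : T i i ^+ 2 <= A i i.
  rewrite AE mxE (bigD1 i)//= !mxE -expr2 lerDl.
  by apply: sumr_ge0 => j _; rewrite mxE -expr2 sqr_ge0.
have -> : \det A = \prod_i T i i ^+ 2.
  by rewrite AE det_gram_square det_trig// prodrXl.
apply: (@le_trans _ _ (\prod_i A i i)).
  by apply: ler_prod => i _; rewrite sqr_ge0 diag.
have [|le _] := @leif_AGM _ _ 'I_r (fun i => A i i).
  by move=> i _; apply: le_trans (diag i); rewrite sqr_ge0.
by rewrite card_ord in le.
Qed.

(** With [X *m X^T = T *m T^T], the positive definite matrix [T^T *m (Y *m Y^T) *m T] has the left
    side as determinant and the squared norm of [X^T *m Y] as trace. *)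
Lemma trace_mul_gram_ge (r m n : nat) (X : 'M[R]_(r, m)) (Y : 'M[R]_(r, n)) :
  row_free X -> row_free Y ->
  \det (X *m X^T) * \det (Y *m Y^T) <= (mxdot (X^T *m Y) (X^T *m Y) / r%:R) ^+ r.
Proof.
move=> Xf Yf; have [T _ AE] := cholesky (gram_posdef Xf).
have := posdef_det_gt0 (gram_posdef Xf).
rewrite AE det_gram_square => dT.
have Tu : row_free T^T.
  rewrite row_free_unit unitmx_tr unitmxE unitfE.
  by apply: contraTneq dT => ->; rewrite expr0n ltxx.
have /gram_posdef/posdef_det_le_trace : row_free (T^T *m Y) by rewrite /row_free mxrankMfree.
have -> : T^T *m Y *m (T^T *m Y)^T = T^T *m (Y *m Y^T) *m T.
  by rewrite trmx_mul trmxK !mulmxA.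
rewrite !det_mulmx [\det T^T]det_tr mulrAC -expr2; congr (_ <= (_ / _) ^+ _).
rewrite mxdotE trmx_mul trmxK [LHS]mxtrace_mulC !mulmxA -AE.
by rewrite [RHS]mxtrace_mulC !mulmxA.
Qed.

End PositiveDefinite.

(** * Integer coordinates of lattice vectors *)

Section Lattices.
Context {R : realType}.

Local Notation "Z ^R" := (map_mx (intr : int -> R) Z) (at level 2).

Lemma lattice_basisP (n : nat) (B : 'M[R]_n) (L : set 'rV[R]_n) :
  is_lattice_basis B L ->
  forall x, L x <-> exists z : 'rV[int]_n, x = z^R *m B.
Proof.
move=> [_ ->] x; split=> [[z _ <-]|[z ->]].
  exists (\row_i z i); rewrite mulmx_sum_row.
  by apply: eq_bigr => i _; rewrite !mxE scaler_int.
exists (z 0) => //; rewrite mulmx_sum_row.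
by apply: eq_bigr => i _; rewrite !mxE scaler_int.
Qed.

Lemma lattice_basis_rowsP (r n : nat) (B : 'M[R]_n) (L : set 'rV[R]_n)
    (X : 'M[R]_(r, n)) :
  is_lattice_basis B L ->
  (forall i, L (row i X)) <-> exists Z : 'M[int]_(r, n), X = Z^R *m B.
Proof.
move=> hB; have LB := lattice_basisP hB; split=> [LX|[Z ->] i]; last first.
  by apply/LB; exists (row i Z); rewrite row_mul map_row.
have /choice[z zP] i : exists z : 'rV[int]_n, row i X = z^R *m B.
  exact/LB.
exists (\matrix_(i, j) z i 0 j); apply/row_matrixP => i.
rewrite zP row_mul -map_row; congr (_^R *m _).
by apply/rowP => j; rewrite !mxE.
Qed.

Lemma lattice_mulmx (p r n : nat) (L : set 'rV[R]_n) (X : 'M[R]_(r, n))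
    (Z : 'M[int]_(p, r)) :
  is_lattice L -> (forall i, L (row i X)) -> forall i, L (row i (Z^R *m X)).
Proof.
move=> [B LB] /(lattice_basis_rowsP _ LB)[W ->].
by apply/(lattice_basis_rowsP _ LB); exists (Z *m W); rewrite map_mxM mulmxA.
Qed.

Lemma trmx_mul_sum_tensor (r m n : nat) (X : 'M[R]_(r, m)) (Y : 'M[R]_(r, n)) :
  X^T *m Y = \sum_i tensor (row i X) (row i Y).
Proof.
apply/matrixP => i j; rewrite summxE mxE; apply: eq_bigr => k _.
by rewrite [RHS]mxE big_ord1 !mxE.
Qed.

(** * Tensor rank and linear independence *)

Lemma sum_of_tensorsP (m n : nat) (L : set 'rV[R]_m) (M : set 'rV[R]_n) v r :
  sum_of_tensors L M v r <->
  exists (X : 'M[R]_(r, m)) (Y : 'M[R]_(r, n)),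
    [/\ forall i, L (row i X), forall i, M (row i Y) & v = X^T *m Y].
Proof.
split=> [[x [y [Lx My ->]]]|[X [Y [LX MY ->]]]].
  exists (\matrix_i x i), (\matrix_i y i); split=> [i|i|]; rewrite ?rowK//.
  by rewrite trmx_mul_sum_tensor; apply: eq_bigr => i _; rewrite !rowK.
by exists (fun i => row i X), (fun i => row i Y); rewrite trmx_mul_sum_tensor.
Qed.

Lemma sum_of_tensors_tr (m n : nat) (L : set 'rV[R]_m) (M : set 'rV[R]_n) v r :
  sum_of_tensors L M v r -> sum_of_tensors M L v^T r.
Proof.
move=> /sum_of_tensorsP[X [Y [LX MY ->]]]; apply/sum_of_tensorsP.
by exists Y, X; rewrite trmx_mul trmxK.
Qed.

Lemma row_free_intmx (n : nat) (U : 'M[int]_n) : U \in unitmx -> row_free U^R.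
Proof.
move=> Uu; rewrite row_free_unit unitmxE det_map_mx.
by apply: rmorph_unit; rewrite -unitmxE.
Qed.

(* The Smith normal form of the coordinates of [X] yields generators of the
   lattice spanned by its rows, one of which is zero if [X] is not free. *)
Lemma sum_of_tensors_drop (r m n : nat) (L : set 'rV[R]_m) (M : set 'rV[R]_n)
    (X : 'M[R]_(r.+1, m)) (Y : 'M[R]_(r.+1, n)) :
  is_lattice L -> is_lattice M ->
  (forall i, L (row i X)) -> (forall i, M (row i Y)) ->
  ~~ row_free X -> sum_of_tensors L M (X^T *m Y) r.
Proof.
move=> [B LB] hM LX MY Xfree.
have [Z XE] := (lattice_basis_rowsP X LB).1 LX.
have [P Pu [Q Qu [d _ ZE]]] := int_Smith_normal_form Z.
set D := (X in P *m X *m Q) in ZE.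
(* [D] is diagonal: if all its rows were nonzero, it would be free, and so would [X], a product of
   free matrices. *)
have [i0 Di0] : exists i, row i D = 0.
  apply: contrapT => /forallNP D0; case/negP: Xfree.
  rewrite XE ZE !map_mxM /row_free !mxrankMfree ?row_free_intmx//.
  - exact: row_free_intmx.
  - apply: inj_row_free => w wD; apply/rowP => i; rewrite mxE.
    have [j Dij] : exists j, D i j != 0.
      apply: contrapT => /forallNP Di; apply: (D0 i); apply/rowP => j.
      by rewrite [LHS]mxE [RHS]mxE; apply: contrapT => /eqP Dij; exact: (Di j).
    have ij : i = j :> nat.
      by apply: contraNeq Dij => /negbTE; rewrite mxE => ->.
    move/rowP/(_ j): wD; rewrite mxE (bigD1 i)//= big1 => [|k ki].
      rewrite !mxE addr0 => /eqP; rewrite mulf_eq0 => /orP[/eqP//|].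
      by rewrite intr_eq0; move: Dij; rewrite mxE => /negbTE ->.
    rewrite !mxE; case: eqVneq => [kj|_]; last by rewrite mulr0n mulr0.
    by case/eqP: ki; apply: val_inj; rewrite /= kj.
  - by case: LB.
have LX' : forall i, L (row i ((D *m Q)^R *m B)).
  by apply/(lattice_basis_rowsP _ LB); exists (D *m Q).
have MY' := lattice_mulmx P^T hM MY.
(* [P] is moved from [X] over to [Y]; the left factor keeps the zero row [i0] of [D], whose tensor
   is dropped. *)
exists (fun i => row (lift i0 i) ((D *m Q)^R *m B)).
exists (fun i => row (lift i0 i) ((P^T)^R *m Y)); split=> //.
have -> : X^T *m Y = ((D *m Q)^R *m B)^T *m ((P^T)^R *m Y).
  by rewrite XE ZE -map_trmx mulmxA -trmx_mul !map_mxM !mulmxA.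
rewrite trmx_mul_sum_tensor (bigD1_ord i0)//= map_mxM -mulmxA.
by rewrite row_mul -map_row Di0 map_mx0 mul0mx /tensor trmx0 mul0mx add0r.
Qed.

Lemma tensor_rank_row_free (r m n : nat) (L : set 'rV[R]_m) (M : set 'rV[R]_n)
    (X : 'M[R]_(r, m)) (Y : 'M[R]_(r, n)) :
  is_lattice L -> is_lattice M ->
  (forall i, L (row i X)) -> (forall i, M (row i Y)) ->
  X^T *m Y != 0 -> has_tensor_rank L M (X^T *m Y) r ->
  row_free X /\ row_free Y.
Proof.
case: r X Y => [|r] X Y hL hM LX MY v0 [// _ _ rmin].
have no_drop : ~ sum_of_tensors L M (X^T *m Y) r.
  (* Minimality only concerns sums of positive length; the empty sum is excluded by the tensor being
     nonzero. *)
  case: r X Y LX MY v0 rmin => [|r] X Y LX MY v0 rmin sumr.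
    by case: sumr v0 => x [y [_ _ ->]]; rewrite big_ord0 eqxx.
  by have := rmin r.+1 isT sumr; rewrite ltnn.
split; apply: contrapT => /negP nfree; apply: no_drop.
  exact: sum_of_tensors_drop.
rewrite -[X^T *m Y]trmxK trmx_mul trmxK; apply: sum_of_tensors_tr.
exact: sum_of_tensors_drop.
Qed.

(** * Shortest vectors and the Hermite constant *)

Lemma row_free_row_neq0 (r n : nat) (X : 'M[R]_(r, n)) i :
  row_free X -> row i X != 0.
Proof.
move=> Xfree; rewrite rowE mulmx_free_eq0//.
by apply/eqP => /matrixP/(_ 0 i)/eqP; rewrite !mxE !eqxx oner_eq0.
Qed.

Lemma l2norm_gt0 (m n : nat) (v : 'M[R]_(m, n)) : v != 0 -> 0 < l2norm v.
Proof. by move=> v0; rewrite sqrtr_gt0 mxdot_gt0. Qed.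

Lemma l2norm_tensor (m n : nat) (x : 'rV[R]_m) (y : 'rV[R]_n) :
  l2norm (tensor x y) = l2norm x * l2norm y.
Proof. by rewrite /l2norm mxdot_tensor sqrtrM// mxdot_ge0. Qed.

Lemma lambda1_le (m n : nat) (L : set 'M[R]_(m, n)) v :
  L v -> v != 0 -> lambda1 L <= l2norm v.
Proof.
move=> Lv v0; apply: ge_inf; last by exists v.
by exists 0 => _ [w _ <-]; exact: sqrtr_ge0.
Qed.

(** The nonzero vector guards against the default value 0 of [inf] on the empty set. *)
Lemma le_lambda1 (m n : nat) (L : set 'M[R]_(m, n)) (c : R) :
  (exists2 v, L v & v != 0) -> (forall v, L v -> v != 0 -> c <= l2norm v) ->
  c <= lambda1 L.
Proof.
move=> [v Lv v0] cL; apply: lb_le_inf; first by exists (l2norm v), v.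
by move=> _ [w [Lw w0] <-]; exact: cL.
Qed.

Lemma lambda1_ge0 (m n : nat) (L : set 'M[R]_(m, n)) : 0 <= lambda1 L.
Proof.
rewrite /lambda1; set E := image _ _.
have [|/inf_out ->//] := pselect (has_inf E).
by case=> E0 _; apply: lb_le_inf => // _ [w _ <-]; exact: sqrtr_ge0.
Qed.

(** Norms of pure tensors are products; the infimum is taken over [x] for fixed [y], then over [y],
    so no minimum need be attained. *)
Lemma lambda1_tensor_le (m n : nat) (L : set 'rV[R]_m) (M : set 'rV[R]_n) :
  (exists2 x, L x & x != 0) -> (exists2 y, M y & y != 0) ->
  lambda1 (tensor_lattice L M) <= lambda1 L * lambda1 M.
Proof.
move=> L0 M0; set t := lambda1 _.
have tle x y : L x -> x != 0 -> M y -> y != 0 -> t <= l2norm x * l2norm y.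
  move=> Lx x0 My y0; rewrite -l2norm_tensor; apply: lambda1_le.
    exists 1%N, (fun=> 1), (fun=> x), (fun=> y); split=> //.
    by rewrite big_ord1 mulr1z.
  apply/eqP => xy0; have := l2norm_tensor x y; rewrite xy0.
  rewrite /l2norm mxdotE mul0mx mxtrace0 sqrtr0 => /esym/eqP.
  by rewrite mulf_eq0 !gt_eqF// l2norm_gt0.
have tleL y : M y -> y != 0 -> t <= lambda1 L * l2norm y.
  move=> My y0; rewrite -ler_pdivrMr ?l2norm_gt0//; apply: le_lambda1 => // x Lx x0.
  by rewrite ler_pdivrMr ?l2norm_gt0// tle.
(* Division by [lambda1 L] requires it positive; if it is 0, [tleL] already gives the bound. *)
have := lambda1_ge0 L; rewrite le_eqVlt => /predU1P[l0|l_gt0].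
  by case: M0 => y My /(tleL _ My); rewrite -l0 !mul0r.
rewrite mulrC -ler_pdivrMr//; apply: le_lambda1 => // y My y0.
by rewrite ler_pdivrMr// mulrC tleL.
Qed.

(** The Cholesky factor of the Gram matrix spans a full lattice isometric to the sublattice of [L]
    spanned by the rows of [X]. *)
Lemma lambda1_hermite_constant (r m : nat) (L : set 'rV[R]_m)
    (X : 'M[R]_(r, m)) :
  hermite_constant R r != 0 -> (0 < r)%N ->
  is_lattice L -> (forall i, L (row i X)) -> row_free X ->
  lambda1 L ^+ 2 <= hermite_constant R r * \det (X *m X^T) `^ r%:R^-1.
Proof.
move=> h0 r_gt0 hL LX Xfree.
have Xpos := gram_posdef Xfree; have [T _ AE] := cholesky Xpos.
have dT : 0 < `|\det T|.
  rewrite normr_gt0; apply: contraTneq (posdef_det_gt0 Xpos) => dT0.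
  by rewrite AE det_gram_square dT0 expr0n ltxx.
have Tfree : row_free T by rewrite row_free_unit unitmxE unitfE -normr_gt0.
pose LT := [set \sum_(i < r) row i T *~ z i | z in [set: 'I_r -> int]].
have LTb : is_lattice_basis T LT by [].
(* [z *m T] and [z *m X] have the same norm, as [T] and [X] have the same Gram
   matrix. *)
have lambda_le : lambda1 L <= lambda1 LT.
  apply: le_lambda1.
    exists (row (Ordinal r_gt0) T).
      by apply: (lattice_basis_rowsP T LTb).2; exists 1%:M; rewrite map_mx1 mul1mx.
    exact: row_free_row_neq0.
  move=> _ /(lattice_basisP LTb)[z ->].
  rewrite mulmx_free_eq0// => z0.
  have -> : l2norm (z^R *m T) = l2norm (z^R *m X).
    by rewrite /l2norm !mxdotE !trmx_mul !mulmxA -(mulmxA z^R T) -AE !mulmxA.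
  apply: lambda1_le; last by rewrite mulmx_free_eq0.
  by rewrite -[_ *m _](row_id 0); apply: lattice_mulmx.
have hsup : lambda1 LT ^+ 2 / `|\det T| `^ r%:R^-1 ^+ 2 <= hermite_constant R r.
  rewrite -expr_div_n; apply: sup_upper_bound; last by exists LT, T.
  (* As [sup] defaults to 0, a nonzero constant is a genuine supremum. *)
  by apply: contrapT => /sup_out; exact/eqP.
have sqE : \det (X *m X^T) `^ r%:R^-1 = (`|\det T| `^ r%:R^-1) ^+ 2.
  by rewrite AE det_gram_square -real_normK ?num_real// expr2 powRM// -expr2.
rewrite sqE -ler_pdivrMr ?exprn_gt0 ?powR_gt0//; apply: le_trans hsup.
by rewrite ler_pM2r ?invr_gt0 ?exprn_gt0 ?powR_gt0// ler_sqr ?nnegrE ?lambda1_ge0.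
Qed.

End Lattices.

Theorem theorem3 (R : realType) (m n : nat)
    (L : set 'rV[R]_m) (M : set 'rV[R]_n)
    (hL : is_lattice L) (hM : is_lattice M)
    (v : 'M[R]_(m, n)) (hv : tensor_lattice L M v) (hv0 : v != 0)
    (r : nat) (hr : has_tensor_rank L M v r) :
  l2norm v >= Num.sqrt (r%:R / hermite_constant R r ^+ 2)
              * lambda1 (tensor_lattice L M).
Proof.
(* This covers an unbounded set of Hermite ratios, whose [sup] is the junk value
   0, so that Hermite's theorem is not needed. *)
have [h0|h0] := eqVneq (hermite_constant R r) 0.
  by rewrite h0 expr0n invr0 mulr0 sqrtr0 mul0r sqrtr_ge0.
have [r_gt0 /sum_of_tensorsP[X [Y [LX MY vE]]] _] := hr.
move: hr hv0; rewrite {}vE => {v hv} hr hv0.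
have [Xfree Yfree] := tensor_rank_row_free hL hM LX MY hv0 hr.
set v := X^T *m Y in hr hv0 *.
have lambdaL := lambda1_hermite_constant h0 r_gt0 hL LX Xfree.
have lambdaM := lambda1_hermite_constant h0 r_gt0 hM MY Yfree.
have lambdaLM : lambda1 (tensor_lattice L M) <= lambda1 L * lambda1 M.
  pose i0 := Ordinal r_gt0.
  by apply: lambda1_tensor_le; [exists (row i0 X)|exists (row i0 Y)];
    rewrite ?row_free_row_neq0.
(* This is the $r$-th root of [trace_mul_gram_ge]. *)
have dets : (\det (X *m X^T) * \det (Y *m Y^T)) `^ r%:R^-1 <= mxdot v v / r%:R.
  have v_ge0 : 0 <= mxdot v v / r%:R by rewrite divr_ge0 ?mxdot_ge0.
  have -> : mxdot v v / r%:R = ((mxdot v v / r%:R) ^+ r) `^ r%:R^-1.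
    by rewrite -powR_mulrn// -powRrM mulfV ?powRr1// pnatr_eq0 -lt0n.
  apply: ge0_ler_powR.
  - by rewrite invr_ge0.
  - by rewrite nnegrE mulr_ge0 ?ltW ?posdef_det_gt0//; exact: gram_posdef.
  - by rewrite nnegrE exprn_ge0.
  - exact: trace_mul_gram_ge.
rewrite -[leLHS]ger0_norm ?mulr_ge0 ?sqrtr_ge0 ?lambda1_ge0// -sqrtr_sqr.
rewrite ler_sqrt ?mxdot_ge0// exprMn sqr_sqrtr ?divr_ge0 ?sqr_ge0//.
have h2 : 0 < hermite_constant R r ^+ 2 by rewrite exprn_even_gt0.
rewrite mulrAC ler_pdivrMr// mulrC -ler_pdivlMr ?ltr0n//.
(* After squaring, the goal is $\lambda_1(L\otimes M)^2\le\lVert v\rVert^2\gamma_r^2/r$; the two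
   Hermite bounds are multiplied and [dets] closes the chain. *)
apply: (@le_trans _ _ (lambda1 L ^+ 2 * lambda1 M ^+ 2)).
  by rewrite -exprMn ler_sqr ?nnegrE ?mulr_ge0 ?lambda1_ge0.
apply: le_trans (ler_pM _ _ lambdaL lambdaM) _; rewrite ?sqr_ge0//.
rewrite mulrACA -expr2 -powRM; try exact: (ltW (posdef_det_gt0 (gram_posdef _))).
by rewrite [leRHS]mulrAC [leRHS]mulrC ler_pM2l.
Qed.
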